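(* Let $\Pi$ be the pattern of some directed acyclic graph and let $\mathcal{K}=\langle \mathbf{F},\mathbf{R}\rangle$ be a set of background knowledge consistent with $\Pi$. Let $\Pi_2$ be the result of orienting edges of $\Pi$ according to $\mathcal{K}$ and applying the orientation rules R1, R2, R3 and R4, until no further edge can be oriented according to $\mathcal{K}$ and none of the rules is applicable. Then $\Pi_2$ is a maximally oriented graph for $\Pi$ with respect to $\mathcal{K}$; that is: (i) for each undirected edge $A-B$ of $\Pi_2$ there exist consistent DAG extensions $G_1$ and $G_2$ of $\Pi_2$ such that $A\to B$ is in $G_1$ and $B\to A$ is in $G_2$; (ii) every edge $A\to B$ in $\mathbf{R}$ is oriented as $A\to B$ in $\Pi_2$; and (iii) no edge $A\to B$ in $\mathbf{F}$ is oriented as $A\to B$ in $\Pi_2$.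
   Context: All graphs are finite. A partially directed graph is a graph that may have both undirected edges ($A-B$) and directed edges ($A\to B$), with at most one edge between any pair of (distinct) vertices. Two vertices are adjacent if they are joined by an edge of either kind. The pattern of a partially directed graph $G$, $\mathrm{pattern}(G)$, is the partially directed graph with the same adjacencies as $G$ which has a directed edge $A\to B$ if and only if $A\to B$ is in $G$ and there is a vertex $C\neq A$ not adjacent to $A$ with $C\to B$ in $G$ (all other edges are undirected). A partially directed graph $G$ extends a partially directed graph $H$ if they have the same vertices and adjacencies and every directed edge $A\to B$ of $H$ is a directed edge $A\to B$ of $G$. $G$ is a consistent DAG extension of $H$ if $G$ extends $H$, $G$ is a directed acyclic graph, and $\mathrm{pattern}(G)=\mathrm{pattern}(H)$. Background knowledge is a pair $\mathcal{K}=\langle \mathbf{F},\mathbf{R}\rangle$, where $\mathbf{F}$ is a set of forbidden directed edges and $\mathbf{R}$ is a set of required directed edges on the vertex set. $\mathcal{K}$ is consistent with a graph $G$ if there exists a consistent DAG extension $G'$ of $G$ such that every edge $A\to B$ in $\mathbf{R}$ is in $G'$ and no edge $A\to B$ in $\mathbf{F}$ is in $G'$. Orienting an edge according to $\mathcal{K}$ means replacing an undirected edge $A-B$ by $A\to B$ when $A\to B$ is in $\mathbf{R}$ or $B\to A$ is in $\mathbf{F}$. Orientation rules (in each rule the named vertices are distinct; applying a rule replaces an undirected edge by a directed one): R1: if $X\to Y$, $Y-Z$, and $X,Z$ are not adjacent, then orient $Y\to Z$. R2: if $X\to Y$, $Y\to Z$ and $X-Z$, then orient $X\to Z$. R3: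 if $X-Y$, $X-Z$, $X-W$, $Y\to W$, $Z\to W$, and $Y,Z$ are not adjacent, then orient $X\to W$. R4: if $X-Y$, $X-W$, $Y\to Z$, $Z\to W$, $X$ and $Z$ are adjacent (by an edge of any kind), and $Y,W$ are not adjacent, then orient $X\to W$. *)

(* Defs.v *)
From mathcomp Require Import all_boot.
From Stdlib Require Export Relation_Operators.

Set Implicit Arguments.
Unset Strict Implicit.
Unset Printing Implicit Defensive.

(* An undirected edge x - y is stored as both pairs (x, y) and (y, x); a directed
   edge x -> y as the single pair (x, y).  The conditions rule out loops and
   allow at most one edge between two vertices. *)
Definition pdgraph_axiom (V : finType) (arcs lines : {set V * V}) : bool :=
  [forall x, forall y,
     (((x, y) \in arcs) ==> ((y, x) \notin arcs)) &&
     (((x, y) \in lines) ==>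
        [&& x != y, (y, x) \in lines & (x, y) \notin arcs])].

(* Boolean well-formedness makes Leibniz equality of graphs coincide with
   equality of their edge sets. *)
Record pdgraph (V : finType) := PDGraph {
  arcs : {set V * V};
  lines : {set V * V};
  pdgraphP : pdgraph_axiom arcs lines
}.

Section PartiallyDirectedGraphs.

Variable V : finType.
Implicit Types (G H : pdgraph V) (x y z w : V).

Definition directed G : rel V := fun x y => (x, y) \in arcs G.
Definition undirected G : rel V := fun x y => (x, y) \in lines G.
Definition adjacent G : rel V :=
  fun x y => [|| undirected G x y, directed G x y | directed G y x].

Definition pattern_arcs G : {set V * V} :=
  [set e | directed G e.1 e.2 &&
     [exists z, [&& z != e.1, ~~ adjacent G z e.1 & directed G z e.2]]].

Definition pattern_lines G : {set V * V} :=
  [set e | [&& adjacent G e.1 e.2, e \notin pattern_arcs G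
             & (e.2, e.1) \notin pattern_arcs G]].

Lemma pattern_axiom G : pdgraph_axiom (pattern_arcs G) (pattern_lines G).
Proof.
have /forallP wfG := pdgraphP G.
apply/forallP => x; apply/forallP => y.
have /forallP/(_ y)/andP[/implyP axy /implyP lxy] := wfG x.
apply/andP; split; apply/implyP.
  by rewrite !inE /= /directed => /andP[/axy/negPf-> _].
rewrite [in X in X -> _]inE /= => /and3P[adj nxy nyx].
rewrite nxy andbT inE /= nxy nyx !andbT; apply/andP; split.
  apply: contraTneq adj => exy; move: axy lxy.
  rewrite /adjacent /undirected /directed exy.
  by case: (_ \in arcs G) => [/(_ isT)|_] //; case: (_ \in lines G) => // /(_ isT); rewrite eqxx.
move: adj; rewrite /adjacent /undirected /directed.
by case/or3P => [/lxy/and3P[_ -> _]|->|->] //; rewrite ?orbT.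
Qed.

Definition pattern G : pdgraph V := PDGraph (pattern_axiom G).

Definition extends G H : Prop :=
  adjacent G =2 adjacent H /\
  (forall x y, directed H x y -> directed G x y).

(* [cycle] admits closed walks with repeated vertices; excluding these is the
   same as excluding simple directed cycles. *)
Definition is_dag G : Prop :=
  (forall x y, ~~ undirected G x y) /\
  (forall c : seq V, c != [::] -> ~~ cycle (directed G) c).

Definition consistent_dag_extension G H : Prop :=
  [/\ extends G H, is_dag G & pattern G = pattern H].

Record background := Background {
  forbidden : {set V * V};
  required : {set V * V}
}.

Definition consistent_with (K : background) G : Prop :=
  exists G', [/\ consistent_dag_extension G' G,
    forall x y, (x, y) \in required K -> directed G' x y
    & forall x y, (x, y) \in forbidden K -> ~~ directed G' x y].

(* [licensed K G x y]: the background knowledge or one of the four rules allows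
   the undirected edge x - y of G to be replaced by x -> y. *)
Inductive licensed (K : background) G : V -> V -> Prop :=
| LicK x y of undirected G x y &
    ((x, y) \in required K) || ((y, x) \in forbidden K) : licensed K G x y
| LicR1 x y z of uniq [:: x; y; z] &
    directed G x y & undirected G y z & ~~ adjacent G x z : licensed K G y z
| LicR2 x y z of uniq [:: x; y; z] &
    directed G x y & directed G y z & undirected G x z : licensed K G x z
| LicR3 x y z w of uniq [:: x; y; z; w] &
    undirected G x y & undirected G x z & undirected G x w &
    directed G y w & directed G z w & ~~ adjacent G y z : licensed K G x w
| LicR4 x y z w of uniq [:: x; y; z; w] &
    undirected G x y & undirected G x w & directed G y z & directed G z w &
    adjacent G x z & ~~ adjacent G y w : licensed K G x w.

Definition orient_step (K : background) G H : Prop :=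
  exists x y, [/\ licensed K G x y,
    arcs H = (x, y) |: arcs G
    & lines H = lines G :\: [set (x, y); (y, x)]].

(* Orientations by the background knowledge and by the rules may be interleaved
   in any order, as long as nothing is left to orient at the end. *)
Definition orientation_result (K : background) G H : Prop :=
  clos_refl_trans (pdgraph V) (orient_step K) G H /\
  (forall x y, ~ licensed K H x y).

End PartiallyDirectedGraphs.

(* Main.v *)
(* Let D be a DAG extending Pi and respecting K.  Every orientation step agrees
   with D, so D is a consistent DAG extension of H = Pi2; this gives (ii) and
   (iii).  For (i), given a - b in H, a DAG with a -> b is obtained by removing
   potential sinks (as in Dor and Tarsi) one at a time, b before a, and
   orienting each edge toward its earlier removed end.  The rules are inherited
   by induced subgraphs, so it is enough that a subgraph containing a - b always
   has a potential sink other than a.  This follows from a directed version of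
   Dirac's theorem on simplicial vertices of chordal graphs: if S is connected
   by undirected edges, a sink a of D on S is adjacent to all of S or some
   potential sink of S is not adjacent to a. *)
Require Import Defs.
From mathcomp Require Import all_boot.

(** * Partially directed graphs, acyclicity and patterns *)

Section Graphs.

Set Implicit Arguments.
Unset Strict Implicit.
Unset Printing Implicit Defensive.

Variable V : finType.
Implicit Types (G H D : pdgraph V) (x y z w : V).

Lemma directed_asym G x y : directed G x y -> ~~ directed G y x.
Proof.
have /forallP/(_ x)/forallP/(_ y)/andP[/implyP h _] := pdgraphP G.
exact: h.
Qed.

Lemma undirectedP G x y :
  undirected G x y -> [/\ x != y, undirected G y x & ~~ directed G x y].
Proof.
have /forallP/(_ x)/forallP/(_ y)/andP[_ /implyP h] := pdgraphP G.
by move=> /h/and3P[].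
Qed.

Lemma undirected_sym G x y : undirected G x y -> undirected G y x.
Proof. by case/undirectedP. Qed.

Lemma undirectedN G x y : undirected G x y -> ~~ directed G x y.
Proof. by case/undirectedP. Qed.

Lemma undirectedNr G x y : undirected G x y -> ~~ directed G y x.
Proof. by move/undirected_sym/undirectedN. Qed.

Lemma directed_adj G x y : directed G x y -> adjacent G x y.
Proof. by rewrite /adjacent => ->; rewrite orbT. Qed.

Lemma undirected_adj G x y : undirected G x y -> adjacent G x y.
Proof. by rewrite /adjacent => ->. Qed.

Lemma adjacentC G x y : adjacent G x y = adjacent G y x.
Proof.
rewrite /adjacent [directed G x y || _]orbC; congr (_ || _).
by apply/idP/idP => /undirected_sym.
Qed.

Lemma adjacentxx G x : ~~ adjacent G x x.
Proof.
apply/negP => /or3P[/undirectedP[/eqP//]|h|h];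
  by have := directed_asym h; rewrite h.
Qed.

Lemma adjacent_neq G x y : adjacent G x y -> x != y.
Proof. by apply: contraTneq => ->; apply: adjacentxx. Qed.

Lemma pdgraph_eq G H : arcs G = arcs H -> lines G = lines H -> G = H.
Proof.
case: G H => [a l p] [a' l' p'] /= ea el; rewrite -{}ea -{}el in p' *.
by rewrite (eq_irrelevance p p').
Qed.

Lemma pattern_eq G H : adjacent G =2 adjacent H ->
  pattern_arcs G = pattern_arcs H -> pattern G = pattern H.
Proof.
move=> eadj earcs; apply: pdgraph_eq => //=.
rewrite /pattern_lines earcs; apply/setP => e.
by rewrite [LHS]in_set [RHS]in_set eadj.
Qed.

Definition ancestors G x := [set y | connect (directed G) y x].
(** In a DAG this strictly increases along arcs, so it serves as a topological rank and cycles are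
    refuted by comparing numbers. *)
Definition depth G x := #|ancestors G x|.

Lemma dag_depth D x y : is_dag D -> directed D x y -> depth D x < depth D y.
Proof.
move=> [_ acyc] xy; apply/proper_card/properP; split.
  apply/subsetP => z; rewrite !inE => zx.
  exact: connect_trans zx (connect1 xy).
exists y; first by rewrite inE.
rewrite inE; apply/negP => /connectP[p yp ex].
have := acyc (y :: p) isT; rewrite /= rcons_path yp -ex xy //.
Qed.

Lemma ranked_dag D (r : V -> nat) : (forall x y, ~~ undirected D x y) ->
  (forall x y, directed D x y -> r x < r y) -> is_dag D.
Proof.
move=> nund lt_r; split=> // -[//|x p] _; apply/negP => /= xp.
have lt_trans : transitive (relpre r ltn) by move=> ? ? ? /=; apply: ltn_trans.
have : path (relpre r ltn) x (rcons p x) by apply: sub_path xp => ? ? /lt_r.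
move/(order_path_min lt_trans)/allP/(_ x); rewrite mem_rcons mem_head /=.
by rewrite ltnn => /(_ isT).
Qed.

Lemma dag_total D x y : is_dag D -> adjacent D x y ->
  directed D x y \/ directed D y x.
Proof. by move=> [nund _] /or3P[|->|->]; [rewrite (negPf (nund _ _))|left|right]. Qed.

(** An unshielded collider of [D] is visible in [pattern D], which equals [pattern H], and arcs of
    [pattern H] are arcs of [H]. *)
Lemma cde_collider D H x y w : consistent_dag_extension D H ->
  directed D x w -> directed D y w -> x != y -> ~~ adjacent H x y ->
  directed H x w.
Proof.
move=> [[eadj _] _ epat] xw yw nxy nadj.
have : (x, w) \in pattern_arcs D.
  rewrite inE /= xw /=; apply/existsP; exists y.
  by rewrite eq_sym nxy yw eadj adjacentC nadj.
have /(congr1 (@arcs V)) /= -> := epat.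
by rewrite inE => /andP[].
Qed.

(** Equality of patterns reduces to [D] having no unshielded collider that [H] lacks; the last
    hypothesis, used also with [x] and [y] exchanged, gives both arcs of the collider. *)
Lemma cde_intro D H : extends D H -> is_dag D ->
  (forall x y w, directed D x w -> directed D y w -> x != y ->
     ~~ adjacent H x y -> directed H x w) ->
  consistent_dag_extension D H.
Proof.
move=> [eadj sub] dagD coll; split=> //; apply: pattern_eq => //.
apply/setP => -[x w]; rewrite !inE /=; apply/andP/andP => -[xw].
  case/existsP => y /and3P[ny nadj yw].
  rewrite eq_sym in ny; rewrite eadj adjacentC in nadj.
  have xwH := coll x y w xw yw ny nadj; split=> //.
  rewrite adjacentC in nadj; rewrite eq_sym in ny.
  by apply/existsP; exists y; rewrite ny nadj (coll y x w).
case/existsP => y /and3P[ny nadj yw]; split; first exact: sub.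
by apply/existsP; exists y; rewrite ny eadj nadj sub.
Qed.

(** * Soundness of the orientation steps *)

Definition respects (K : background V) D : Prop :=
  (forall x y, (x, y) \in required K -> directed D x y) /\
  (forall x y, (x, y) \in forbidden K -> ~~ directed D x y).

Lemma licensed_undirected K G x y : licensed K G x y -> undirected G x y.
Proof. by case. Qed.

(** If [D] reversed an orientation given by a rule, it would contain a directed cycle (refuted by
    [lt_depth]) or an unshielded collider with an arc undirected in [G] (refuted by [nundl]). *)
Lemma licensed_sound K D G x y : consistent_dag_extension D G ->
  respects K D -> licensed K G x y -> directed D x y.
Proof.
move=> cde [req forb] lic; have := cde => -[[eadj sub] dagD _].
have lt_depth a b := @dag_depth D a b dagD.
have tot a b : adjacent G a b -> directed D a b \/ directed D b a.
  by rewrite -eadj; apply: dag_total.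
have nundl a b c : undirected G a b -> directed D a b -> directed D c b ->
    a != c -> adjacent G a c.
  move=> /undirectedN ab Dab Dcb ac; apply: contraNT ab => nadj.
  exact: cde_collider cde Dab Dcb ac nadj.
have [//|yx] := tot _ _ (undirected_adj (licensed_undirected lic)).
case: lic yx => {x y} [x y und /orP[/req //|/forb/negPf->//]
  |x y z uq xy yz nadj|x y z uq xy yz xz|x y z w uq xy xz xw yw zw nadj
  |x y z w uq xy xw yz zw xz nadj] yx.
- case/negP: nadj; rewrite adjacentC; apply: (nundl _ y) => //.
  + exact: undirected_sym.
  + exact: sub.
  + by move: uq; rewrite /= !inE [z == x]eq_sym; case: (x == z); rewrite ?orbT.
- have := ltn_trans (lt_depth _ _ (sub _ _ xy)) (lt_depth _ _ (sub _ _ yz)).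
  by move/ltn_trans => /(_ _ (lt_depth _ _ yx)); rewrite ltnn.
(* An arc from [x] to [a] in [D] would close a cycle through [a], [w] and [x]. *)
- have into a : undirected G x a -> directed G a w -> directed D a x.
    move=> xa aw; have [Dxa|//] := tot _ _ (undirected_adj xa).
    have := ltn_trans (lt_depth _ _ Dxa) (lt_depth _ _ (sub _ _ aw)).
    by move/ltn_trans => /(_ _ (lt_depth _ _ yx)); rewrite ltnn.
  case/negP: nadj; apply: (nundl _ x) => //;
    [exact: undirected_sym|exact: into|exact: into|].
  by move: uq; rewrite /= !inE; case: (y == z); rewrite ?andbF.
- have [Dxy|Dyx] := tot _ _ (undirected_adj xy).
    have := ltn_trans (lt_depth _ _ (sub _ _ yz)) (lt_depth _ _ (sub _ _ zw)).
    move=> /(ltn_trans (lt_depth _ _ Dxy))/ltn_trans /(_ (lt_depth _ _ yx)).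
    by rewrite ltnn.
  case/negP: nadj; apply: (nundl _ x) => //; first exact: undirected_sym.
  by move: uq; rewrite /= !inE; case: (y == w); rewrite ?orbT ?andbF.
Qed.

Lemma orient_step_sound K D G H : consistent_dag_extension D G ->
  respects K D -> orient_step K G H -> consistent_dag_extension D H.
Proof.
move=> cde resp [x [y [lic earcs elines]]].
have Dxy := licensed_sound cde resp lic.
have [[eadj sub] dagD _] := cde.
have und := licensed_undirected lic.
have dirH a b : directed H a b = ((a, b) == (x, y)) || directed G a b.
  by rewrite /directed earcs !inE.
have undH a b : undirected H a b =
    ~~ (((a, b) == (x, y)) || ((a, b) == (y, x))) && undirected G a b.
  by rewrite /undirected elines !inE.
have adjH : adjacent G =2 adjacent H.
  move=> a b; rewrite /adjacent undH !dirH.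
  have -> : ((b, a) == (x, y)) = ((a, b) == (y, x)).
    by rewrite !xpair_eqE andbC.
  case: eqP => [[-> ->]|_] /=; first by rewrite und ?orbT.
  by case: eqP => [[-> ->]|_] //=; rewrite (undirected_sym und) ?orbT.
have subGH a b : directed G a b -> directed H a b by rewrite dirH orbC => ->.
apply: cde_intro => //.
  split=> [a b|a b]; first by rewrite eadj adjH.
  by rewrite dirH => /predU1P[[-> ->]|/sub].
move=> a b w aw bw nab; rewrite -adjH => nadj.
exact/subGH/(cde_collider cde aw bw nab nadj).
Qed.

Lemma orientation_sound K D G H : consistent_dag_extension D G ->
  respects K D -> clos_refl_trans _ (orient_step K) G H ->
  consistent_dag_extension D H.
Proof.
move=> cde resp steps; elim: steps cde => // {G H}.
- by move=> G H st cde; apply: orient_step_sound st.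
- by move=> G1 G2 G3 _ IH1 _ IH2 /IH1/IH2.
Qed.

End Graphs.

(** * Graphs to which no rule applies, with a fixed DAG extension [D] *)

Section ClosedGraph.

Set Implicit Arguments.
Unset Strict Implicit.
Unset Printing Implicit Defensive.

Variables (V : finType) (K : background V) (H D : pdgraph V).
Hypothesis closedH : forall x y, ~ licensed K H x y.
Hypothesis cdeD : consistent_dag_extension D H.
Implicit Types (x y z w : V) (S T C : {set V}).

Local Notation arc := (directed H).
Local Notation und := (undirected H).
Local Notation adj := (adjacent H).
Local Notation darc := (directed D).
Local Notation rk := (depth D).

Lemma arc_darc x y : arc x y -> darc x y.
Proof. by case: cdeD => -[_ h] _ _; apply: h. Qed.

Lemma darc_rk x y : darc x y -> rk x < rk y.
Proof. by case: cdeD => _ dagD _; apply: dag_depth. Qed.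

Lemma arc_rk x y : arc x y -> rk x < rk y.
Proof. by move/arc_darc/darc_rk. Qed.

Lemma adj_darc x y : adj x y -> darc x y \/ darc y x.
Proof. by case: cdeD => -[eadj _] dagD _; rewrite -eadj; apply: dag_total. Qed.

(** [closed1] to [closed4] turn the inapplicability of R1 to R4 into closure facts. Most
    distinctness conditions follow from adjacencies; [y != w] in [closed4] comes from ranks. *)
Lemma closed1 x y z : arc x y -> und y z -> adj x z.
Proof.
move=> xy yz; apply: contraT => nadj; case: (@closedH y z).
apply: (LicR1 _ _ xy yz nadj); rewrite /= !inE negb_or.
rewrite (adjacent_neq (directed_adj xy)) (adjacent_neq (undirected_adj yz)).
rewrite !andbT; apply: contraTneq yz => <-.
by apply: contraL xy => /undirectedNr.
Qed.

Lemma closed2 x y z : arc x y -> arc y z -> ~~ und x z.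
Proof.
move=> xy yz; apply/negP => xz; case: (@closedH x z).
apply: (LicR2 _ _ xy yz xz); rewrite /= !inE negb_or.
rewrite (adjacent_neq (directed_adj xy)) (adjacent_neq (directed_adj yz)).
by rewrite (adjacent_neq (undirected_adj xz)).
Qed.

Lemma closed3 x y z w : und x y -> und x z -> und x w -> arc y w -> arc z w ->
  y != z -> adj y z.
Proof.
move=> xy xz xw yw zw nyz; apply: contraT => nadj; case: (@closedH x w).
apply: (LicR3 _ _ xy xz xw yw zw nadj); rewrite /= !inE !negb_or nyz.
rewrite (adjacent_neq (undirected_adj xy)) (adjacent_neq (undirected_adj xz)).
rewrite (adjacent_neq (undirected_adj xw)) (adjacent_neq (directed_adj yw)).
by rewrite (adjacent_neq (directed_adj zw)).
Qed.

Lemma closed4 x y z w : und x y -> und x w -> arc y z -> arc z w -> adj x z ->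
  adj y w.
Proof.
move=> xy xw yz zw xz; apply: contraT => nadj; case: (@closedH x w).
apply: (LicR4 _ _ xy xw yz zw xz nadj); rewrite /= !inE !negb_or.
rewrite (adjacent_neq (undirected_adj xy)) (adjacent_neq xz).
rewrite (adjacent_neq (undirected_adj xw)) (adjacent_neq (directed_adj yz)).
rewrite (adjacent_neq (directed_adj zw)) !andbT /=.
apply: contraTneq (ltn_trans (arc_rk yz) (arc_rk zw)) => ->.
by rewrite ltnn.
Qed.

(** R2 rules out an undirected [x - z], and ranks rule out an arc from [z] to [x]. *)
Lemma arc_trans x y z : arc x y -> arc y z -> adj x z -> arc x z.
Proof.
move=> xy yz /or3P[xz|//|zx]; first by have := closed2 xy yz; rewrite xz.
have := ltn_trans (ltn_trans (arc_rk xy) (arc_rk yz)) (arc_rk zx).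
by rewrite ltnn.
Qed.

Lemma ex_last S x0 : x0 \in S ->
  exists2 x, x \in S & forall y, y \in S -> rk y <= rk x.
Proof. by move=> Sx0; case: (arg_maxnP rk Sx0) => x; exists x. Qed.

(** Making such an [x] a sink of [S] reverses no arc and creates no new unshielded collider. Two
    neighbours both joined to [x] by arcs may be non-adjacent: that collider is already in [H]. *)
Definition potential_sink S x :=
  [&& x \in S, [forall y in S, ~~ arc x y]
    & [forall y in S, forall z in S,
        [&& und x y, adj x z & y != z] ==> adj y z]].

Lemma potential_sinkP S x :
  reflect [/\ x \in S, forall y, y \in S -> ~~ arc x y
            & forall y z, y \in S -> z \in S -> und x y -> adj x z ->
                y != z -> adj y z]
          (potential_sink S x).
Proof.
apply: (iffP and3P) => -[Sx noarc simp]; split=> //.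
- exact/forall_inP.
- move=> y z Sy Sz xy xz nyz.
  have /forall_inP/(_ z Sz)/implyP := forall_inP simp y Sy.
  by rewrite xy xz nyz; apply.
- exact/forall_inP.
apply/forall_inP => y Sy; apply/forall_inP => z Sz.
by apply/implyP => /and3P[]; apply: simp.
Qed.

Definition dag_sink S x := x \in S /\ forall y, y \in S -> ~~ darc x y.

Lemma ex_dag_sink S x0 : x0 \in S -> exists x, dag_sink S x.
Proof.
case/ex_last => x Sx max; exists x; split=> // y Sy.
by apply/negP => /darc_rk; rewrite ltnNge max.
Qed.

Lemma dag_sink_parent S x y : dag_sink S x -> y \in S -> adj y x -> darc y x.
Proof. by move=> [_ nox] Sy /adj_darc[//|]; rewrite (negPf (nox y Sy)). Qed.

(** If [y] and [z] were not adjacent, they would form an unshielded collider of [D] at [x], forcing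
    [x - y] to be an arc of [H]. *)
Lemma dag_sink_potential S x : dag_sink S x -> potential_sink S x.
Proof.
move=> sx; have [Sx nox] := sx; apply/potential_sinkP; split=> // [y Sy|].
  by apply: contra (nox y Sy); apply: arc_darc.
move=> y z Sy Sz xy xz nyz; apply: contraT => nadj.
have /undirectedNr/negP[] := xy; apply: (cde_collider cdeD _ _ nyz nadj).
  by apply: (dag_sink_parent sx Sy); rewrite adjacentC undirected_adj.
by apply: (dag_sink_parent sx Sz); rewrite adjacentC.
Qed.

(* Connectedness of S through undirected edges, stated with cuts: an undirected
   edge leaves every nonempty proper subset T of S. *)
Definition und_connected S := forall T x y, T \subset S -> x \in T ->
  y \in S -> y \notin T -> exists u v, [/\ u \in T, v \in S, v \notin T & und u v].

(** * Components under undirected edges *)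

Definition component S x :=
  [set y in S | connect [rel u v | [&& und u v, u \in S & v \in S]] x y].

Lemma component_sub S x : component S x \subset S.
Proof. by apply/subsetP => y; rewrite inE => /andP[]. Qed.

Lemma component_id S x : x \in S -> x \in component S x.
Proof. by move=> Sx; rewrite inE Sx connect0. Qed.

Lemma component_closed S x u v : u \in component S x -> v \in S ->
  und u v -> v \in component S x.
Proof.
rewrite !inE => /andP[Su xu] Sv uv; rewrite Sv /=.
by apply: connect_trans xu (connect1 _); rewrite /= uv Su Sv.
Qed.

Lemma component_sym S : connect_sym [rel u v | [&& und u v, u \in S & v \in S]].
Proof.
apply: sym_connect_sym => u v /=; rewrite [(u \in S) && _]andbC.
by congr (_ && _); apply/idP/idP => /undirected_sym.
Qed.

Lemma component_eq S x y : y \in component S x -> component S y = component S x.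
Proof.
rewrite inE => /andP[_ xy]; apply/setP => z.
by rewrite !inE (same_connect (@component_sym S) xy).
Qed.

Lemma component_connected S x : und_connected (component S x).
Proof.
move=> T t y sTC Tt Cy nTy.
pose e := [rel u v | [&& und u v, u \in S & v \in S]].
have : connect e t y.
  have := subsetP sTC t Tt; move: Cy; rewrite !inE => /andP[_ xy] /andP[_ xt].
  by apply: connect_trans xy; rewrite component_sym.
(* The first step of the path that leaves [T] is the required edge. *)
case/connectP => p; elim: p t Tt => [|v p IHp] u Tu /=.
  by move=> _ ey; rewrite ey Tu in nTy.
case/andP => /and3P[uv Su Sv] pth ey; case Tv: (v \in T); first exact: IHp Tv _ _.
exists u, v; rewrite Tu Tv; split=> //.
exact: component_closed (subsetP sTC u Tu) Sv uv.
Qed.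

(** Suppose [a - b] leaves the set of children of [u] in [C]. R1 makes [u] and [b] adjacent, [u - b]
    is excluded by hypothesis, and an arc from [b] to [u] contradicts R2, so [b] is a child too. *)
Lemma arc_spreads C u v w : und_connected C ->
  (forall a, a \in C -> ~~ und u a) -> v \in C -> arc u v -> w \in C ->
  arc u w.
Proof.
move=> conC nund Cv uv Cw; pose T := [set a in C | arc u a].
have sTC : T \subset C by apply/subsetP => a; rewrite inE => /andP[].
have Tv : v \in T by rewrite inE Cv.
case nTw: (w \in T); first by move: nTw; rewrite inE => /andP[].
have [a [b [Ta Cb nTb ab]]] := conC T v w sTC Tv Cw (negbT nTw).
move: Ta nTb; rewrite !inE Cb /= => /andP[Ca ua] nub.
have /or3P[|ub|bu] := closed1 ua ab; first by rewrite (negPf (nund b Cb)).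
  by rewrite ub in nub.
by have := closed2 bu ua; rewrite undirected_sym.
Qed.

(* By R1 and R2, an arc entering a component from outside reaches all of it. *)
Lemma component_arc S x u v w : u \in S -> u \notin component S x ->
  v \in component S x -> arc u v -> w \in component S x -> arc u w.
Proof.
move=> Su nCu; apply: (arc_spreads (@component_connected S x)) => a Ca.
by apply: contra nCu => /undirected_sym; apply: component_closed.
Qed.

(** Let [a - b] leave the set of common children of [x] and [y]. By R1 and R2 each of [x], [y] has
    an undirected edge to [b] or an arc into it. Two undirected edges give adjacency by R3, one of
    each by R1, and two arcs would put [b] in the set. *)
Lemma connected_collider S x y w : und_connected S ->
  x \in S -> y \in S -> w \in S -> arc x w -> arc y w -> x != y -> adj x y.
Proof.
move=> conS Sx Sy Sw xw yw nxy; pose T := [set v in S | arc x v && arc y v].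
have sTS : T \subset S by apply/subsetP => a; rewrite inE => /andP[].
have Tw : w \in T by rewrite inE Sw xw.
have nTx : x \notin T.
  by rewrite !inE Sx /=; apply/nandP; left; apply/negP => /arc_rk; rewrite ltnn.
have [a [b [Ta Sb nTb ab]]] := conS T w x sTS Tw Sx nTx.
move: Ta nTb; rewrite !inE Sb /= => /and3P[Sa xa ya] nb.
have ends c : arc c a -> und c b \/ arc c b.
  move=> ca; have /or3P[|cb|bc] := closed1 ca ab; [by left|by right|].
  by have := closed2 bc ca; rewrite undirected_sym.
have [xb|xb] := ends x xa; have [yb|yb] := ends y ya.
- by apply: (closed3 _ _ (undirected_sym ab) xa ya nxy); apply: undirected_sym.
- by rewrite adjacentC; apply: closed1 yb (undirected_sym xb).
- by apply: closed1 xb (undirected_sym yb).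
- by rewrite xb yb in nb.
Qed.

(** Otherwise [D] has an unshielded collider at [a]; its arcs are then in [H], against
    [connected_collider]. *)
Lemma dag_sink_clique S a y z : und_connected S -> dag_sink S a ->
  y \in S -> z \in S -> adj y a -> adj z a -> y != z -> adj y z.
Proof.
move=> conS sa Sy Sz ya za nyz; apply: contraT => nadj.
have dya := dag_sink_parent sa Sy ya; have dza := dag_sink_parent sa Sz za.
have aya := cde_collider cdeD dya dza nyz nadj.
rewrite eq_sym in nyz; rewrite adjacentC in nadj.
have aza := cde_collider cdeD dza dya nyz nadj.
by have := connected_collider conS Sz Sy sa.1 aza aya nyz; rewrite (negPf nadj).
Qed.

(** Undirected neighbours of [y] in [S] lie in its component. Any other neighbour in [S] sends an
    arc to [y], hence to the whole component. *)
Lemma component_potential_sink S x y : potential_sink (component S x) y ->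
  (forall w, w \in S -> ~~ arc y w) -> potential_sink S y.
Proof.
case/potential_sinkP => Cy _ simp noarc.
have sCS := subsetP (component_sub S x); apply/potential_sinkP; split=> //.
  exact: sCS.
move=> u v Su Sv yu yv nuv; have Cu := component_closed Cy Su yu.
case Cv: (v \in component S x); first exact: simp.
case/or3P: yv => [yv|yv|vy].
- by rewrite (component_closed Cy Sv yv) in Cv.
- by have := noarc v Sv; rewrite yv.
- rewrite adjacentC; apply: directed_adj.
  exact: component_arc Sv (negbT Cv) Cy vy Cu.
Qed.

Lemma potential_sink_setD1 S a y : potential_sink (S :\ a) y -> ~~ adj y a ->
  potential_sink S y.
Proof.
case/potential_sinkP => /setD1P[_ Sy] noarc simp nya.
have nb v : v \in S -> adj y v -> v \in S :\ a.
  by move=> Sv yv; rewrite !inE Sv andbT; apply: contraNneq nya => <-.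
apply/potential_sinkP; split=> // [w Sw|u v Su Sv yu yv].
  apply: contraL isT => yw; have := noarc w (nb w Sw (directed_adj yw)).
  by rewrite yw.
apply: simp => //; apply: nb => //; exact: undirected_adj.
Qed.

(** The child [y] of [z] of highest rank works: by completeness and R2, a child of [y] would be a
    later child of [z]. *)
Lemma complete_potential_sink S z w :
  (forall u v, u \in S -> v \in S -> u != v -> adj u v) ->
  z \in S -> w \in S -> arc z w ->
  exists2 y, potential_sink S y & arc z y.
Proof.
move=> complS Sz Sw zw; pose T := [set y in S | arc z y].
have Tw : w \in T by rewrite inE Sw.
have [y Ty max] := ex_last Tw.
move: (Ty); rewrite inE => /andP[Sy zy]; exists y => //.
apply/potential_sinkP; split=> // [v Sv|u v Su Sv _ _]; last exact: complS.
apply/negP => yv; have lt_yv := arc_rk yv.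
suff /max : v \in T by rewrite leqNgt lt_yv.
rewrite inE Sv; apply: (arc_trans zy yv); apply: complS => //.
by apply: contraTneq (ltn_trans (arc_rk zy) lt_yv) => ->; rewrite ltnn.
Qed.

(* Induction through the components C of S minus a.  If no potential sink of S
   avoids the neighbours of a, then the potential sinks of C are all neighbours
   of a, hence pairwise adjacent, and by induction C is complete.  A vertex z of
   C not adjacent to a then has an arc to a potential sink y -> a of C, and R4
   applies to z, y, a and a vertex c of C with c - a. *)
Lemma dag_sink_dichotomy S a : und_connected S -> dag_sink S a ->
  (forall z, z \in S -> z != a -> adj z a) \/
  exists x, [/\ potential_sink S x, x != a & ~~ adj x a].
Proof.
have [m] := ubnP #|S|; elim: m S a => // m IHm S a ltSm conS sa.
have Sa : a \in S by case: sa.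
case: (pickP [pred x | [&& potential_sink S x, x != a & ~~ adj x a]]) => [x|nps].
  by case/and3P => ? ? ?; right; exists x.
left=> z Sz nza; set S' := S :\ a.
have S'z : z \in S' by rewrite !inE nza.
have sub' u : u \in S' -> u \in S by case/setD1P.
(* An undirected edge of [S] leaves each component of [S'], and it can only end at [a]. *)
have link u : u \in S' -> exists2 c, c \in component S' u & und c a.
  move=> S'u; have sC := subsetP (component_sub S' u).
  have [||c [v [Cc Sv nCv cv]]] := conS _ u a _ (component_id S'u) Sa.
  - by apply/subsetP => v /sC/sub'.
  - by apply/negP => /sC; rewrite !inE eqxx.
  exists c => //; case: (eqVneq v a) cv nCv => [-> //|nva] cv.
  by rewrite (component_closed Cc _ cv) // !inE nva.
set C := component S' z; have sC := subsetP (component_sub S' z).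
(* Otherwise [y] would be a potential sink of [S]: an arc from [y] into another component would
   spread to a vertex [c] there with [c - a], and R1 would make [y] adjacent to [a]. *)
have psC y : potential_sink C y -> adj y a.
  move=> psy; apply: contraFT (nps y) => nya /=.
  have Cy : y \in C by case/potential_sinkP: psy.
  have S'y := sC y Cy; rewrite nya andbT.
  rewrite [y != a](setD1P S'y).1 andbT.
  apply: potential_sink_setD1 (nya); apply: component_potential_sink (psy) _.
  move=> w S'w; apply: contra nya => yw.
  have [c Cc ca] := link w S'w; apply: closed1 (ca).
  case Cwy: (y \in component S' w).
    have /potential_sinkP[_ noarc _] := psy.
    suff /noarc : w \in C by rewrite yw.
    by rewrite /C -(component_eq Cy) (component_eq Cwy) component_id.
  exact: component_arc (S'y) (negbT Cwy) (component_id S'w) yw Cc.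
have [b sb] := ex_dag_sink (component_id S'z).
have conC : und_connected C by apply: component_connected.
have ltCm : #|C| < m.
  apply: leq_trans (ltSm : #|S| <= m); apply: proper_card; apply/properP.
  split; first by apply/subsetP => u /sC/sub'.
  by exists a => //; apply/negP => /sC; rewrite !inE eqxx.
have Cb : b \in C by case: sb.
have ba := psC b (dag_sink_potential sb).
(* By induction, a failure gives a potential sink [x] of [C] not adjacent to [b]; but both are
   neighbours of [a]. *)
have allb u : u \in C -> u != b -> adj u b.
  case: (IHm C b ltCm conC sb) => [|[x [psx nxb nadj]]]; first exact.
  have Sx : x \in S by case/potential_sinkP: psx => /sC/sub'.
  case/negP: nadj; apply: (dag_sink_clique conS sa) => //; last exact: psC.
  exact/sub'/sC.
have complC u v : u \in C -> v \in C -> u != v -> adj u v.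
  move=> Cu Cv nuv; have [eub|nub] := eqVneq u b.
    by rewrite adjacentC eub allb // -eub eq_sym.
  have [->|nvb] := eqVneq v b; first exact: allb.
  exact: (dag_sink_clique conC sb Cu Cv (allb u Cu nub) (allb v Cv nvb)).
have [c Cc ca] := link z S'z.
apply: contraT => nza'.
have nzc : z != c by apply: contraNneq nza' => ->; apply: undirected_adj.
have Cz : z \in C := component_id S'z.
(* With no arc into [C], [z] would be a potential sink of the complete set [C], hence adjacent to
   [a]. *)
have [w Cw zw] : exists2 w, w \in C & arc z w.
  apply/exists_inP; apply: contraT => /exists_inPn noarc.
  case/negP: nza'; apply: psC; apply/potential_sinkP; split=> // u v Cu Cv _ _.
  exact: complC.
have [y psy zy] := complete_potential_sink complC Cz Cw zw.
have Cy : y \in C by case/potential_sinkP: psy.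
have ya : arc y a.
  case/or3P: (psC y psy) => // [ya|ay]; first by rewrite (closed1 zy ya) in nza'.
  by have := sa.2 y (sub' y (sC y Cy)); rewrite (arc_darc ay).
have ncy : c != y by apply: contraTneq ya => <-; apply: undirectedN.
have cy := complC c y Cc Cy ncy.
(* The three kinds of edge between [z] and [c] contradict R4, R1 and R2 respectively. *)
case/or3P: (complC z c Cz Cc nzc) => [zc|zc|cz].
- by have := closed4 (undirected_sym zc) ca zy ya cy; rewrite (negPf nza').
- by have := closed1 zc ca; rewrite (negPf nza').
- by have := closed2 (arc_trans cz zy cy) ya; rewrite ca.
Qed.

(** If [a] is adjacent to all of [S], then [S] is complete, and the last vertex other than [a] with
    no arc to [a] is a potential sink: by R2 its children would also have no arc to [a]. *)
Lemma connected_potential_sink S a b : und_connected S -> dag_sink S a ->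
  b \in S -> b != a -> exists2 x, potential_sink S x & x != a.
Proof.
move=> conS sa Sb nba; have [Sa _] := sa.
case: (dag_sink_dichotomy conS sa) => [alla|[x [psx nxa _]]]; last by exists x.
have [||u [v []]] := conS [set a] a b _ (set11 a) Sb; rewrite ?sub1set ?inE //.
move=> /eqP -> Sv nva av.
pose Y := [set y in S | (y != a) && ~~ arc y a].
have Yv : v \in Y by rewrite inE Sv nva undirectedNr.
have [y Yy max] := ex_last Yv.
move: (Yy); rewrite inE => /and3P[Sy nya nay]; exists y => //.
apply/potential_sinkP; split=> // [w Sw|p q Sp Sq _ _ npq].
  apply/negP => yw; have lt_yw := arc_rk yw.
  suff /max : w \in Y by rewrite leqNgt lt_yw.
  rewrite inE Sw /=; apply/andP; split.
    by apply: contraNneq nay => <-.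
  by apply: contra nay => wa; apply: arc_trans yw wa (alla y Sy nya).
have [epa|npa] := eqVneq p a; first by rewrite adjacentC epa alla // -epa eq_sym.
have [->|nqa] := eqVneq q a; first exact: alla.
exact: (dag_sink_clique conS sa Sp Sq (alla p Sp npa) (alla q Sq nqa)).
Qed.

(** * Sink components and a second potential sink *)

Lemma ex_sink_component S x0 : x0 \in S -> exists2 r, r \in S &
  forall c w, c \in component S r -> w \in S -> w \notin component S r ->
    ~~ arc c w.
Proof.
(* The component whose D-first vertex comes last has no outgoing arc, since an
   arc into another component reaches all of it. *)
pose M := [set x in S | [forall y in component S x, rk x <= rk y]].
have first_of x : x \in S -> exists2 y, y \in component S x & y \in M.
  move=> Sx; case: (arg_minnP rk (component_id Sx)) => y Cy min; exists y => //.
  rewrite inE (subsetP (component_sub S x)) //=.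
  by apply/forall_inP => z; rewrite (component_eq Cy); apply: min.
move=> /first_of[x _ Mx]; have [r Mr max] := ex_last Mx.
move: (Mr); rewrite inE => /andP[Sr /forall_inP minr]; exists r => // c w Cc Sw nCw.
apply/negP => cw; have [v Cv /max] := first_of w Sw.
rewrite leqNgt => /negP[]; apply: leq_ltn_trans (minr c Cc) _; apply: arc_rk.
apply: component_arc (component_id Sw) cw Cv.
  exact: (subsetP (component_sub S r)).
apply: contra nCw => Cwc.
by rewrite -(component_eq Cc) (component_eq Cwc) component_id.
Qed.

(** Potential sinks of a sink component are potential sinks of [S]. If its sink in [D] is [a], the
    component also contains [b] and has another one. *)
Lemma other_potential_sink S a b : a \in S -> b \in S -> und a b ->
  exists2 x, potential_sink S x & x != a.
Proof.
move=> Sa Sb ab; have [r Sr sinkC] := ex_sink_component Sa.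
have psC x : potential_sink (component S r) x -> potential_sink S x.
  move=> psx; apply: (component_potential_sink psx) => w Sw.
  have /potential_sinkP[Cx noarc _] := psx.
  by case Cw: (w \in component S r); [apply: noarc | apply: sinkC (negbT Cw)].
have [d sd] := ex_dag_sink (component_id Sr).
have [eda|nda] := eqVneq d a; last by exists d => //; apply/psC/dag_sink_potential.
rewrite {d}eda in sd; have Cb := component_closed sd.1 Sb ab.
have [nab _ _] := undirectedP ab; rewrite eq_sym in nab.
have [x /psC psx nxa] := connected_potential_sink (@component_connected S r) sd Cb nab.
by exists x.
Qed.

(** * Elimination orders *)

Fixpoint elimination (s : seq V) : bool :=
  if s is x :: s' then potential_sink [set y in s] x && elimination s' else true.

Lemma elimination_cons S x s : potential_sink S x -> S :\ x =i s ->
  elimination s -> S =i x :: s /\ elimination (x :: s).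
Proof.
move=> psx es els; have Sx : x \in S by case/potential_sinkP: psx.
have eS : S =i x :: s.
  move=> y; rewrite inE -es !inE; case: (eqVneq y x) => [->|] //.
split=> //=; rewrite els andbT.
by have -> : [set y in x :: s] = S by apply/setP => y; rewrite inE eS.
Qed.

Lemma ex_elimination S : exists2 s, S =i s & elimination s.
Proof.
have [m] := ubnP #|S|; elim: m S => // m IHm S ltSm.
have [->|[x0 Sx0]] := set_0Vmem S.
  by exists [::] => // x; rewrite !inE.
have [x sx] := ex_dag_sink Sx0.
have [s es els] : exists2 s, S :\ x =i s & elimination s.
  by apply: IHm; move: ltSm; rewrite (cardsD1 x) sx.1.
by case: (elimination_cons (dag_sink_potential sx) es els); exists (x :: s).
Qed.

(** Potential sinks other than [a] are removed until [b] goes; meanwhile [a - b] survives, so one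
    always exists. After [b], any elimination order will do. *)
Lemma ex_elimination_before S a b : a \in S -> b \in S -> und a b ->
  exists s, [/\ S =i s, elimination s & index b s < index a s].
Proof.
have [m] := ubnP #|S|; elim: m S => // m IHm S ltSm Sa Sb ab.
have [x psx nxa] := other_potential_sink Sa Sb ab.
have Sx : x \in S by case/potential_sinkP: psx.
have [exb|nxb] := eqVneq x b.
  have [s es els] := ex_elimination (S :\ x).
  have [eS elS] := elimination_cons psx es els.
  by exists (x :: s); split=> //=; rewrite (negPf nxa) exb eqxx.
have [s [es els lt_ba]] : exists s,
    [/\ S :\ x =i s, elimination s & index b s < index a s].
  apply: IHm => //; first by move: ltSm; rewrite (cardsD1 x) Sx.
    by rewrite !inE eq_sym nxa.
  by rewrite !inE eq_sym nxb.
have [eS elS] := elimination_cons psx es els.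
by exists (x :: s); split=> //=; rewrite (negPf nxa) (negPf nxb).
Qed.

(** Vertices of larger index are still present when [x] is removed as a potential sink. *)
Lemma elimination_index s x y : elimination s -> x \in s -> y \in s ->
  index x s < index y s -> ~~ arc x y /\
  forall z, z \in s -> index x s < index z s -> y != z -> und x y -> adj x z ->
    adj y z.
Proof.
elim: s => //= t s IHs /andP[pst els] xts yts.
have [etx|ntx] := eqVneq t x.
  have /potential_sinkP[_ noarc simp] := pst; rewrite etx in noarc simp yts *.
  move=> _; split; first by rewrite noarc ?inE // -in_cons.
  by move=> z zts _ nyz xy xz; apply: simp; rewrite // inE.
have mem v : v \in t :: s -> t != v -> v \in s.
  by rewrite inE eq_sym => /predU1P[->|//]; rewrite eqxx.
have [//|nty] := eqVneq t y; rewrite ltnS => ltxy.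
have [noarc simp] := IHs els (mem x xts ntx) (mem y yts nty) ltxy.
split=> // z zts; have [//|ntz] := eqVneq t z; rewrite ltnS.
exact/simp/mem.
Qed.

(** * The DAG of an elimination order *)

Section OrientByElimination.

Variable s : seq V.

Definition toward_earlier : {set V * V} :=
  [set e | adj e.1 e.2 && (index e.2 s < index e.1 s)].

Lemma toward_earlier_axiom : pdgraph_axiom toward_earlier set0.
Proof.
apply/forallP => x; apply/forallP => y; rewrite !inE /= andbT.
by apply/implyP => /andP[_ lt_yx]; rewrite negb_and -leqNgt (ltnW lt_yx) orbT.
Qed.

Definition elimination_dag := PDGraph toward_earlier_axiom.

Lemma directed_elimination_dag x y :
  directed elimination_dag x y = adj x y && (index y s < index x s).
Proof. by rewrite /directed inE. Qed.

Lemma elimination_dag_cde : elimination s -> (forall x, x \in s) ->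
  consistent_dag_extension elimination_dag H.
Proof.
move=> els all_s; have nund x y : ~~ undirected elimination_dag x y.
  by rewrite /undirected inE.
have noarc x y : index x s < index y s -> ~~ arc x y.
  by move=> lt_xy; case: (elimination_index els (all_s x) (all_s y) lt_xy).
have idx_neq x y : x != y -> (index x s < index y s) || (index y s < index x s).
  rewrite -neq_ltn; apply: contra_neq => eq_xy.
  by rewrite -(nth_index x (all_s x)) eq_xy nth_index.
have forward x y : arc x y -> index y s < index x s.
  move=> xy; have := idx_neq x y (adjacent_neq (directed_adj xy)).
  by case/orP => // /noarc; rewrite xy.
apply: cde_intro; first split.
- move=> x y; rewrite {1}/adjacent (negPf (nund x y)) !directed_elimination_dag.
  rewrite [adjacent H y x]adjacentC -andb_orr /=.
  case xy: (adj x y) => //=; rewrite orbC.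
  exact/idx_neq/(adjacent_neq xy).
- move=> x y xy; rewrite directed_elimination_dag directed_adj //.
  exact: forward.
(* Arcs go toward smaller indices, so the rank counts positions from the end of [s]. *)
- apply: (ranked_dag (r := fun x => size s - index x s)) => // x y.
  rewrite directed_elimination_dag => /andP[_ lt_yx].
  by rewrite ltn_sub2l // (leq_trans lt_yx) // index_size.
(* A new collider at [w] would have both parents present when [w] is removed, so the potential sink
   condition would shield it. *)
move=> x y w; rewrite !directed_elimination_dag.
move=> /andP[xw lt_wx] /andP[yw lt_wy] nxy nadj.
have [nwx simp] := elimination_index els (all_s w) (all_s x) lt_wx.
case/or3P: xw => // [xw|wx]; last by rewrite wx in nwx.
case/negP: nadj; apply: simp => //; first exact: undirected_sym.
by rewrite adjacentC.
Qed.

End OrientByElimination.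

Lemma ex_cde_directed a b : und a b ->
  exists2 G, consistent_dag_extension G H & directed G a b.
Proof.
move=> ab.
have [s [all_s els lt_ba]] := ex_elimination_before (in_setT a) (in_setT b) ab.
exists (elimination_dag s).
  by apply: elimination_dag_cde => // x; rewrite -all_s inE.
by rewrite directed_elimination_dag undirected_adj.
Qed.

End ClosedGraph.

Theorem theorem4 (V : finType) (Pi : pdgraph V) (K : background V)
    (Pi2 : pdgraph V)
    (hPi : exists D : pdgraph V, is_dag D /\ Pi = pattern D)
    (hK : consistent_with K Pi)
    (hPi2 : orientation_result K Pi Pi2) :
  [/\ forall A B : V, undirected Pi2 A B ->
        exists G1 G2 : pdgraph V,
          [/\ consistent_dag_extension G1 Pi2, consistent_dag_extension G2 Pi2,
              directed G1 A B & directed G2 B A],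
      forall A B : V, (A, B) \in required K -> directed Pi2 A B
    & forall A B : V, (A, B) \in forbidden K -> ~~ directed Pi2 A B].
Proof.
case: hK => D [cdePi req forb]; case: hPi2 => steps closed2.
have cde : consistent_dag_extension D Pi2.
  exact: (orientation_sound cdePi (conj req forb) steps).
have [[eadj sub] _ _] := cde.
(* A required edge cannot stay undirected, since [LicK] would orient it, nor be reversed, since [D]
   contains it. *)
have known A B : directed D A B -> (A, B) \in required K ->
    directed Pi2 A B.
  move=> AB reqAB; have := directed_adj AB.
  rewrite eadj => /or3P[und|//|/sub BA].
    by case: (closed2 A B); apply: LicK und _; rewrite reqAB.
  by have := directed_asym AB; rewrite BA.
split=> [A B AB|A B reqAB|A B forbAB].
- have [G1 cde1 AB1] := ex_cde_directed closed2 cde AB.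
  have [G2 cde2 BA2] := ex_cde_directed closed2 cde (undirected_sym AB).
  by exists G1, G2.
- exact: known (req A B reqAB) reqAB.
- by apply: contra (forb A B forbAB); apply: sub.
Qed.
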